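(* Let $d\ge1$ be an integer. For every positive integer $k<d+1$, there does not exist a $k$-list replicable algorithm for the $d$-Threshold Estimation Problem in the PAC model under the uniform distribution.
   Context: $d$-Threshold Estimation Problem: let $X=[0,1]^d$. For each $\vec t\in[0,1]^d$ let $h_{\vec t}:X\to\{0,1\}$ be given by $h_{\vec t}(\vec x)=1$ if $x_i\le t_i$ for every $i\in\{1,\dots,d\}$, and $h_{\vec t}(\vec x)=0$ otherwise. Let $\mathcal{H}=\{h_{\vec t}:\vec t\in[0,1]^d\}$. The problem is to learn $\mathcal{H}$. For a distribution $\mathcal{D}$ over $X$ and $f\in\mathcal{H}$, $\mathcal{D}_f$ is the distribution over $X\times\{0,1\}$ obtained by sampling $x\sim\mathcal{D}$ and outputting $\langle x,f(x)\rangle$. A hypothesis is a (measurable) function $h:X\to\{0,1\}$; its error is $e_{\mathcal{D}_f}(h)=\Pr_{x\sim\mathcal{D}}[f(x)\ne h(x)]$, and it is $\varepsilon$-approximate if $e_{\mathcal{D}_f}(h)\le\varepsilon$. A $k$-list replicable algorithm for $\mathcal{H}$ under the uniform distribution is a (possibly randomized) algorithm $A$ such that, with $\mathcal{D}$ the uniform distribution on $X=[0,1]^d$, for all $0<\varepsilon<1$ and $0<\delta\le1$ there is a sample size $m=m(\varepsilon,\delta)$ such that for every $f\in\mathcal{H}$ there is a list $L$ of at most $k$ $\varepsilon$-approximate hypotheses for which $A$, on inputs $\delta,\varepsilon$ and $S\sim\mathcal{D}_f^m$ ($m$ i.i.d. samples), satisfies $\Pr[A(S)\in L]\ge1-\delta$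 (over $S$ and the internal randomness of $A$). *)

(* Defs.v *)
From HB Require Import structures.
From mathcomp Require Import all_boot all_order all_algebra.
From mathcomp Require Import all_classical all_reals all_analysis.

Set Implicit Arguments.
Unset Strict Implicit.
Unset Printing Implicit Defensive.
Import Order.TTheory GRing.Theory Num.Theory.
Import numFieldNormedType.Exports.
Local Open Scope classical_set_scope.
Local Open Scope ring_scope.

Definition unit_interval (R : realType) : Type := {x : R | 0 <= x <= 1}.

Section unit_interval.
Variable R : realType.
Local Notation I := (unit_interval R).

HB.instance Definition _ := Choice.on I.

Let zero_in01 : 0 <= (0 : R) <= 1. Proof. by rewrite lexx ler01. Qed.

HB.instance Definition _ := isPointed.Build I (exist _ (0 : R) zero_in01).

(* The trace on [0,1] of the Borel sigma-algebra of R. *)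
HB.instance Definition _ := Measurable.copy I
  (g_sigma_algebra_preimageType (\val : I -> measurableTypeR R)).

Lemma measurable_unit_val :
  measurable_fun setT (\val : I -> measurableTypeR R).
Proof. by move=> _ B mB; exists B. Qed.

Lemma image_unit_val (B : set R) :
  [set val x | x in (\val : I -> R) @^-1` B] = B `&` `[0, 1].
Proof.
apply/seteqP; split => [_ [x Bx <-]|r [Br]] /=.
  by split=> //; rewrite in_itv /=; case: x {Bx}.
by rewrite in_itv /= => r01; exists (exist _ r r01).
Qed.

Lemma measurable_image_unit_val (A : set I) : measurable A ->
  measurable ([set val x | x in A] : set (measurableTypeR R)).
Proof.
case=> B mB <-; rewrite setTI image_unit_val.
by apply: measurableI => //; exact: measurable_itv.
Qed.

Definition uniform01 (A : set I) : \bar R :=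
  lebesgue_measure ([set val x | x in A] : set (measurableTypeR R)).

Let uniform01_0 : uniform01 set0 = 0%E.
Proof. by rewrite /uniform01 image_set0 measure0. Qed.

Let uniform01_ge0 A : (0 <= uniform01 A)%E.
Proof. exact: measure_ge0. Qed.

Let uniform01_sigma_additive : semi_sigma_additive uniform01.
Proof.
move=> F mF tF mUF; rewrite /uniform01 image_bigcup.
apply: measure_semi_sigma_additive.
- by move=> n; exact: measurable_image_unit_val.
- apply/trivIsetP => i j _ _ ij.
  rewrite -subset0 => r [[x Fx <-] [y Fy /val_inj yx]].
  move/trivIsetP : tF => /(_ i j Logic.I Logic.I ij) Fij0.
  have : (F i `&` F j) x by split => //; rewrite -yx.
  by rewrite Fij0.
- by rewrite -image_bigcup; exact: measurable_image_unit_val.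
Qed.

HB.instance Definition _ := isMeasure.Build _ _ _ uniform01
  uniform01_0 uniform01_ge0 uniform01_sigma_additive.

Let uniform01_setT : uniform01 setT = 1%E.
Proof.
rewrite /uniform01 -(preimage_setT (\val : I -> R)) image_unit_val setTI.
by rewrite lebesgue_measure_itv /= lte_fin ltr01 oppr0 adde0.
Qed.

HB.instance Definition _ :=
  Measure_isProbability.Build _ _ _ uniform01 uniform01_setT.

End unit_interval.

Section power_probability.
Context {dT : measure_display} {T : measurableType dT} {R : realType}.

Definition tuple_cons (n : nat) (p : T * n.-tuple T) : n.+1.-tuple T :=
  [the n.+1.-tuple T of p.1 :: p.2].

Let measurable_tuple_cons (n : nat) : measurable_fun setT (@tuple_cons n).
Proof. exact: measurable_cons. Qed.

HB.instance Definition _ (n : nat) :=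
  isMeasurableFun.Build _ _ _ _ (@tuple_cons n) (@measurable_tuple_cons n).

Fixpoint power_prob (P : probability T R) (n : nat) :
    probability (n.-tuple T) R :=
  match n with
  | 0%N => dirac [tuple]
  | n'.+1 => distribution (P \x power_prob P n')%E (@tuple_cons n')
  end.

(* This rule characterises power_prob P n as the n-fold product of P. *)
Lemma power_prob_box (P : probability T R) (n : nat) (A : 'I_n -> set T) :
  (forall i, measurable (A i)) ->
  power_prob P n [set t | forall i, A i (tnth t i)] = (\prod_(i < n) P (A i))%E.
Proof.
elim: n A => [|n IHn] A mA.
  rewrite big_ord0 /= diracE mem_set //= => -[] //.
rewrite big_ord_recl /= /distribution /pushforward.
rewrite -(IHn (fun i => A (lift ord0 i))) // -product_measure1E //; last first.
  rewrite (_ : [set _ | _] = \bigcap_(i in [set: 'I_n])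
      ((fun t : n.-tuple T => tnth t i) @^-1` A (lift ord0 i))); last first.
    by apply/seteqP; split=> t At i; [move=> _; exact: At|exact: (At i Logic.I)].
  apply: fin_bigcap_measurable => // i _.
  by rewrite -[X in measurable X]setTI; exact: measurable_tnth.
congr (_ _); apply/seteqP; split => [[x t] At|[x t] [Ax At] i] /=.
  split; first exact: (At ord0).
  by move=> i; have := At (lift ord0 i); rewrite tnthS.
by case: (unliftP ord0 i) => [j ->|->] /=; rewrite ?tnthS; [exact: At|].
Qed.

End power_probability.

Section pac.
Context {dX : measure_display} {X : measurableType dX} {R : realType}.

Local Notation hypothesis := {mfun X >-> bool}.

Definition labelled (f : hypothesis) (x : X) : X * bool := (x, f x).

Let measurable_labelled (f : hypothesis) : measurable_fun setT (labelled f).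
Proof. exact: measurable_fun_pair. Qed.

HB.instance Definition _ (f : hypothesis) :=
  isMeasurableFun.Build _ _ _ _ (labelled f) (measurable_labelled f).

Definition example_dist (D : probability X R) (f : hypothesis) :
    probability (X * bool)%type R :=
  distribution D (labelled f).

Definition error (D : probability X R) (f h : hypothesis) : \bar R :=
  D [set x | f x <> h x].

Definition approximate (D : probability X R) (f : hypothesis) (eps : R)
    (h : hypothesis) : Prop :=
  (error D f h <= eps%:E)%E.

End pac.

(* The internal randomness is drawn from an arbitrary probability space.
   Hypotheses carry no sigma-algebra; measurable_run is what is needed for the
   events "the output is h", hence "the output is in L" for a finite list L,
   to have a probability. *)
Record randomized_algorithm (dX : measure_display) (X : measurableType dX)
    (R : realType) := RandomizedAlgorithm {
  coins_display : measure_display;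
  coins : measurableType coins_display;
  coins_prob : probability coins R;
  run : forall (delta eps : R) (m : nat),
    m.-tuple (X * bool) -> coins -> {mfun X >-> bool};
  measurable_run : forall (delta eps : R) (m : nat) (h : {mfun X >-> bool}),
    measurable [set z : m.-tuple (X * bool) * coins |
                run delta eps z.1 z.2 = h]
}.
Arguments coins {dX X R} _.
Arguments coins_prob {dX X R} _.
Arguments run {dX X R} _ _ _ {m} _ _.
Arguments measurable_run {dX X R} _ _ _ {m} _.

Definition list_replicable (dX : measure_display) (X : measurableType dX)
    (R : realType) (D : probability X R) (H : set {mfun X >-> bool}) (k : nat)
    (A : randomized_algorithm X R) : Prop :=
  forall eps delta : R, 0 < eps < 1 -> 0 < delta <= 1 ->
  exists m : nat, forall f, H f ->
  exists L : seq {mfun X >-> bool},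
    [/\ (size L <= k)%N,
        forall h, h \in L -> approximate D f eps h &
        ((1 - delta)%:E <=
          (power_prob (example_dist D f) m \x coins_prob A)
            [set z | run A delta eps z.1 z.2 \in L])%E].

Definition cube (R : realType) (d : nat) : Type := d.-tuple (unit_interval R).

Section threshold.
Context {R : realType} {d : nat}.

Definition threshold (t x : cube R d) : bool :=
  [forall i, val (tnth x i) <= val (tnth t i)].

Let measurable_threshold (t : cube R d) : measurable_fun setT (threshold t).
Proof.
apply: (@measurable_fun_bool _ _ _ _ true); rewrite setTI.
rewrite (_ : _ @^-1` _ = \bigcap_(i in [set: 'I_d])
    ((fun x : d.-tuple (unit_interval R) => tnth x i) @^-1`
      (\val @^-1` [set r : R | r <= val (tnth t i)]))); last first.
  apply/seteqP; split => [x /= /forallP xt i _|x xt]; first exact: xt.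
  by apply/forallP => i; exact: xt.
apply: fin_bigcap_measurable => // i _.
rewrite -[X in measurable X]setTI; apply: measurable_tnth => //.
exists [set r : R | r <= val (tnth t i)]; last by rewrite setTI.
rewrite (_ : [set _ | _] = `]-oo, val (tnth t i)]%classic); last first.
  by apply/seteqP; split => r; rewrite /= in_itv.
exact: measurable_itv.
Qed.

HB.instance Definition _ (t : cube R d) :=
  isMeasurableFun.Build _ _ _ _ (threshold t) (measurable_threshold t).

Definition threshold_class : set {mfun cube R d >-> bool} :=
  [set (threshold t : {mfun cube R d >-> bool}) | t in [set: cube R d]].

End threshold.

Definition uniform_cube (R : realType) (d : nat) : probability (cube R d) R :=
  power_prob (@uniform01 R) d.

(* Main.v *)
(** Let p_t(h) be the probability that the algorithm outputs h when the target is
    the threshold at t.  It varies slowly with t, since the laws of the sample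
    at s and t are within m Pr[h_s <> h_t] of each other.  With
    delta = 1/(k+2) some h in the list at t has p_t(h) >= (1-delta)/k > delta;
    colour each point t of a fine grid of [1/2,1]^d by such an h.  An h that is
    eps-accurate for t and s cannot have t_i = 1/2 and s_i = 1, so labelling t by
    the first i such that its colour is eps-accurate for some point of the face
    {t_i = 1/2} (or by d if there is none) meets the boundary conditions of
    Kuhn's cubical Sperner lemma.  Hence some grid cell carries d+1 colours, all
    of which have probability more than delta at one single vertex t of the
    cell, hence lie in the list at t: so d+1 <= k. *)

Require Import Defs.
From mathcomp Require Import all_boot all_order all_algebra fingroup perm.
From mathcomp Require Import all_classical all_reals all_analysis.
From mathcomp Require Import measurable_realfun zify ring lra.

Set Implicit Arguments.
Unset Strict Implicit.
Unset Printing Implicit Defensive.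

(** * Kuhn's cubical Sperner lemma *)

(** If omitting [j] leaves all the labels 0..n, the other n+1 vertices carry each of them exactly
    once. When [w j] is n+1, no other vertex can be omitted and all labels occur. Otherwise [w j]
    repeats the label of one other vertex: exactly these two can be omitted, and n+1 is missing. *)
Lemma odd_almost_onto (n : nat) (w : 'I_n.+2 -> nat) :
  (forall j, w j <= n.+1) ->
  \big[addb/false]_(j < n.+2)
     [forall l : 'I_n.+1, exists j' : 'I_n.+2, (j' != j) && (w j' == l)] =
  [forall l : 'I_n.+2, exists j : 'I_n.+2, w j == l].
Proof.
move=> wn; set good := fun j : 'I_n.+2 =>
  [forall l : 'I_n.+1, exists j' : 'I_n.+2, (j' != j) && (w j' == l)].
have goodP j : reflect (forall l, l <= n -> exists2 j', j' != j & w j' = l) (good j).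
  apply: (iffP forallP) => [H l ln|H l].
    have /existsP[j' /andP[jj /eqP]] := H (Ordinal (ln : l < n.+1)).
    by exists j'.
  have [j' jj wj] := H l (ltn_ord l).
  by apply/existsP; exists j'; rewrite jj wj eqxx.
have inj_good j : good j ->
    {in [pred a | a != j] &, injective w} /\ forall a, a != j -> w a <= n.
  move=> /goodP gj; pose f a := inord (w a) : 'I_n.+2.
  have fE a : f a = w a :> nat by rewrite /f inordK // ltnS.
  (* These are the ordinals up to n. They lie in the image of the n+1 vertices other than [j], so by
     cardinality [f] is injective there with image [S]. *)
  pose S := [set lift ord_max l | l in [set: 'I_n.+1]]%SET.
  have cS : #|S| = n.+1 by rewrite card_imset ?cardsT ?card_ord //; exact: lift_inj.
  have cA : #|[set~ j]%SET| = n.+1 by rewrite cardsC1 card_ord.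
  have SA : S \subset [set f a | a in [set~ j]]%SET.
    apply/fintype.subsetP => _ /imsetP[l _ ->].
    have [j' jj wl] := gj l (ltn_ord l).
    apply/imsetP; exists j'; rewrite ?inE //.
    by apply/ord_inj; rewrite lift_max fE wl.
  have /eqP SE : S == [set f a | a in [set~ j]]%SET.
    by rewrite eqEcard SA cS (leq_trans (leq_imset_card _ _)) ?cA.
  have finj : {in [set~ j]%SET &, injective f} by apply/imset_injP; rewrite -SE cS cA.
  split=> [a b aj bj ab|a aj].
    by apply: finj; rewrite ?inE //; apply/val_inj; rewrite /= !fE.
  have : f a \in S by rewrite SE; apply/imsetP; exists a; rewrite ?inE.
  by case/imsetP => l _ /(congr1 (@nat_of_ord _)); rewrite fE => ->; rewrite lift_max -ltnS.
have [[j0 gj0]|nog] := pselect (exists j, good j); last first.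
  rewrite big1; last by move=> j _; apply/negbTE/negP => gj; apply: nog; exists j.
  apply/esym/negbTE/negP => /forallP H; apply: nog.
  have /existsP[j0 /eqP wj0] := H ord_max.
  exists j0; apply/goodP => l ln.
  have /existsP[j' /eqP wj'] := H (inord l).
  rewrite inordK in wj'; last by rewrite ltnS ltnW.
  exists j' => //; apply/eqP => jj; move: wj0; rewrite -jj wj' /= => ll.
  by rewrite ll ltnn in ln.
have [injw ranw] := inj_good _ gj0; have sj0 := elimT (goodP _) gj0.
have [wj0|wj0] := leqP (w j0) n; last first.
  rewrite (bigD1 j0) //= -/(good j0) gj0 big1.
    apply/esym/forallP => l; apply/existsP.
    have [ln|ln] := leqP l n.
      by have [j' _ /eqP] := sj0 l ln; exists j'.
    by exists j0; rewrite eqn_leq (leq_trans _ wj0) ?(leq_trans _ ln) // -ltnS ltn_ord.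
  move=> j jj; apply/negbTE/negP => /goodP /(_ (w j) (ranw _ jj))[a aj wa].
  have [aj0|aj0] := eqVneq a j0.
    by move: wj0; rewrite ltnNge -aj0 wa ranw.
  by move: aj; rewrite (injw a j) ?inE ?eqxx.
have [j1 j10 wj1] := sj0 _ wj0.
rewrite (bigD1 j0) //= -/(good j0) gj0 (bigD1 j1) //= -/(good j1).
have -> : good j1.
  apply/goodP => l ln; have [a aj0 wa] := sj0 _ ln.
  have [aj1|aj1] := eqVneq a j1; last by exists a.
  by exists j0; rewrite ?(eq_sym j0) // -wj1 -aj1.
rewrite big1; last first.
  move=> j /andP[jj0 jj1]; apply/negbTE/negP => /inj_good[inj _].
  by move: j10; rewrite (inj j1 j0) ?inE ?eqxx // eq_sym.
apply/esym/negbTE/negP => /forallP /(_ ord_max) /existsP[a /eqP wa].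
have [aj0|aj0] := eqVneq a j0; first by move: wj0; rewrite -aj0 wa ltnn.
by have := ranw _ aj0; rewrite wa ltnn.
Qed.

(** * Parity count over Kuhn's triangulation *)

Section kuhn_triangulation.
Variables (d N : nat).
Implicit Types (v : {ffun 'I_d -> 'I_N.+1}) (r : 'S_d) (n j : nat).

(* The simplex (v, r) of Kuhn's triangulation walks from v to the opposite corner
   of the unit cube at v; its step from vertex j to vertex j+1 is along the
   direction c with r c = j. Swapping two adjacent ranks changes only one
   vertex, and that is why every interior facet is shared by two simplices. *)
Definition kuhn_vertex v r j : 'I_d -> nat := fun c => v c + (r c < j).

Definition low n : {set 'I_d} := [set c : 'I_d | c < n]%SET.

(* For n < d the parity argument runs inside the face where all coordinates
   from n on vanish, so that no change of dimension is needed in the induction. *)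
Definition base n v : bool :=
  [forall c : 'I_d, if c < n then v c < N else v c == 0 :> nat].

Definition onto_labels n (w : nat -> nat) : bool :=
  [forall l : 'I_n.+1, exists j : 'I_n.+1, w j == l].

Lemma onto_labelsP n (w : nat -> nat) :
  reflect (forall l, l <= n -> exists2 j, j <= n & w j = l) (onto_labels n w).
Proof.
apply: (iffP forallP) => [H l ln|H l].
  have /existsP[j /eqP wj] := H (Ordinal (ln : l < n.+1)).
  by exists j => //; rewrite -ltnS.
have [|j jn wj] := H l; first by rewrite -ltnS ltn_ord.
by apply/existsP; exists (Ordinal (jn : j < n.+1)); rewrite /= wj.
Qed.

(** Acting on ranks, [s] makes the first of n+1 steps the last one and advances all others by one;
    this is the rotation in [outer_facets]. *)
Lemma rotation_exists n : n < d -> exists s : 'S_d,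
  perm_on (low n.+1) s /\
  forall c : 'I_d, c <= n -> s c = (if c == 0 :> nat then n else c.-1) :> nat.
Proof.
move=> nd.
pose g (c : 'I_d) := if c == 0 :> nat then n else if c <= n then c.-1 else c.
have gd c : g c < d.
  by rewrite /g; do ! case: ifP => // _; rewrite (leq_ltn_trans (leq_pred _)).
pose f c := Ordinal (gd c).
have fE c : f c = g c :> nat by [].
have fi : injective f.
  move=> a b /(congr1 (@nat_of_ord _)); rewrite !fE /g => ab; apply/ord_inj.
  by move: ab; do ! case: ifP => ?; lia.
exists (perm fi); split.
  apply/fintype.subsetP => c; rewrite !inE permE; apply: contraR.
  rewrite -leqNgt => nc; apply/eqP/ord_inj; rewrite fE /g.
  by do ! case: ifP => ?; lia.
by move=> c cn; rewrite permE fE /g cn.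
Qed.

Variable lab : ('I_d -> nat) -> nat.
Hypothesis lab_le : forall x, lab x <= d.
Hypothesis lab0 : forall x (i : 'I_d), x i = 0 -> lab x <= i.
Hypothesis labN : forall x (i : 'I_d), x i = N -> lab x != i.

Definition complete n v r : bool := onto_labels n (fun j => lab (kuhn_vertex v r j)).

(** As [r] fixes the directions from n on, the vertices 0..n move only inside the n-dimensional face
    of [base]. *)
Definition simplex n v r : bool := base n v && perm_on (low n) r.

Lemma perm_on_low n r (c : 'I_d) : perm_on (low n) r -> n <= c -> r c = c.
Proof. by move=> pr nc; rewrite (out_perm pr) // inE -leqNgt. Qed.

(** For n < d, coordinate n vanishes at these vertices and [lab0] applies. *)
Lemma lab_simplex n v r j : simplex n v r -> j <= n -> lab (kuhn_vertex v r j) <= n.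
Proof.
move=> /andP[/forallP bv pr] jn.
have [nd|dn] := ltnP n d; last by rewrite (leq_trans _ dn).
apply: (lab0 (i := Ordinal nd)); rewrite /kuhn_vertex (perm_on_low pr) //=.
by have := bv (Ordinal nd); rewrite /= ltnn => /eqP ->; rewrite add0n ltnNge jn.
Qed.

(** The facets opposite vertex [k] selected here are the doors of the usual parity proof of
    Sperner's lemma. *)
Definition almost n (w : nat -> nat) k : bool :=
  [forall l : 'I_n.+1, exists j : 'I_n.+2, (j != k :> nat) && (w j == l)].

Lemma almostP n (w : nat -> nat) k :
  reflect (forall l, l <= n -> exists j, [/\ j <= n.+1, j != k & w j = l])
    (almost n w k).
Proof.
apply: (iffP forallP) => [H l ln|H l].
  have /existsP[j /andP[jk /eqP wj]] := H (Ordinal (ln : l < n.+1)).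
  by exists j; split => //; rewrite -ltnS.
have [|j [jn jk wj]] := H l; first by rewrite -ltnS ltn_ord.
by apply/existsP; exists (Ordinal (jn : j < n.+2)); rewrite /= wj jk /=.
Qed.

Lemma complete_almost n v r : simplex n.+1 v r ->
  complete n.+1 v r =
  \big[addb/false]_(k < n.+2) almost n (fun j => lab (kuhn_vertex v r j)) k.
Proof.
move=> vr; rewrite -[LHS](odd_almost_onto (w := fun j : 'I_n.+2 => lab (kuhn_vertex v r j))) //.
by move=> j; apply: lab_simplex => //; rewrite -ltnS.
Qed.

(** Exchanging the ranks k-1 and k is an involution on the simplices that preserves the facet
    opposite vertex [k], so the terms cancel in pairs. *)
Lemma inner_facets n k : n < d -> 0 < k <= n ->
  \big[addb/false]_(p : {ffun 'I_d -> 'I_N.+1} * 'S_d | simplex n.+1 p.1 p.2)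
    almost n (fun j => lab (kuhn_vertex p.1 p.2 j)) k = false.
Proof.
move=> nd /andP[k0 kn].
have kd : k < d by lia.
have kd' : k.-1 < d by lia.
pose a := Ordinal kd'; pose b := Ordinal kd; pose t := tperm a b.
have ab : a != b by apply/eqP => /(congr1 (@nat_of_ord _)) /=; lia.
have tE (p : 'S_d) c j : j != k -> ((p * t)%g c < j) = (p c < j).
  move=> jk; rewrite permM /t; case: tpermP => [->|->|//] /=; lia.
(* [up] selects one simplex of each pair: the exchange of ranks always negates it. *)
pose up (p : {ffun 'I_d -> 'I_N.+1} * 'S_d) := ((p.2^-1)%g a < (p.2^-1)%g b).
rewrite (bigID up) /=.
pose h (p : {ffun 'I_d -> 'I_N.+1} * 'S_d) := (p.1, p.2 * t)%g.
have hK : involutive h by move=> [v r]; rewrite /h /= -mulgA tperm2 mulg1.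
rewrite [X in _ (+) X](reindex_inj (inv_inj hK)) /=.
rewrite [X in _ (+) X](eq_bigr (fun p => almost n (fun j => lab (kuhn_vertex p.1 p.2 j)) k));
  last first.
  move=> [v r] _ /=; apply: eq_forallb => l; apply: eq_existsb => j.
  case: eqVneq => //= jk; congr (lab _ == _).
  by apply/funext => c; rewrite /kuhn_vertex tE.
rewrite [X in _ (+) X](eq_bigl (fun p => simplex n.+1 p.1 p.2 && up p)) ?addbb // => -[v r] /=.
have pt : perm_on (low n.+1) t.
  apply: (fintype.subset_trans (tperm_on a b)); apply/fintype.subsetP => c.
  by rewrite !inE => /orP[] /eqP -> /=; lia.
have upE : ~~ up (v, r * t)%g = up (v, r).
  rewrite /up /= invMg tpermV !permM tpermL tpermR -leqNgt leq_eqVlt.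
  by rewrite (inj_eq (@ord_inj _)) (inj_eq perm_inj) (negbTE ab).
rewrite upE /simplex; congr (_ && _ && _).
apply/idP/idP => pr; last exact: perm_onM.
by rewrite -[r]mulg1 -(tperm2 a b) mulgA perm_onM.
Qed.

(** [ord_pred] is cyclic, which makes the shift injective; a coordinate wrapped around from 0
    becomes N, which [base] rejects in the free directions. *)
Definition shift_down v (i : 'I_d) : {ffun 'I_d -> 'I_N.+1} :=
  [ffun c => if c == i then ord_pred (v c) else v c].

Lemma shift_downE v (i c : 'I_d) :
  shift_down v i c =
  (if c == i then (if v c == 0 :> nat then N else (v c).-1) else v c) :> nat.
Proof.
rewrite ffunE; case: ifP => // _ /=.
have [v0|v0] := eqVneq (v c : nat) 0; first by rewrite v0 add0n /= modn_small.
have vN : v c < N.+1 by [].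
by rewrite addnS /= -(prednK (n := v c)) ?lt0n //= addSn -addnS modnDr modn_small //; lia.
Qed.

(* The facet opposite vertex 0 of (w, r') is the facet opposite vertex n+1 of the
   simplex obtained by moving w one step in its first direction and rotating r'. *)
Lemma outer_facets n (nd : n < d) :
  \big[addb/false]_(p : {ffun 'I_d -> 'I_N.+1} * 'S_d | simplex n.+1 p.1 p.2)
    almost n (fun j => lab (kuhn_vertex p.1 p.2 j)) 0 =
  \big[addb/false]_(p : {ffun 'I_d -> 'I_N.+1} * 'S_d |
      simplex n.+1 (shift_down p.1 (p.2^-1 (Ordinal nd))%g) p.2)
    complete n p.1 p.2.
Proof.
have [s [ps sE]] := rotation_exists nd.
set on := Ordinal nd.
pose h (p : {ffun 'I_d -> 'I_N.+1} * 'S_d) :=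
  (shift_down p.1 (p.2^-1 on)%g, p.2 * s^-1)%g.
have hi : injective h.
  move=> [v r] [v' r'] [+ /mulIg rr]; rewrite -{r'}rr => vv; congr (_, _).
  apply/ffunP => c; move/ffunP/(_ c) : vv; rewrite !ffunE.
  by case: ifP => // _ /(can_inj (@ord_predK _)).
rewrite (reindex_inj hi) /=.
have pE r : perm_on (low n.+1) (r * s^-1)%g = perm_on (low n.+1) r.
  apply/idP/idP => pr; last by rewrite perm_onM // perm_onV.
  by rewrite -[r](mulgKV s) perm_onM.
apply: eq_big => [[v r]|[v r]] /=; first by rewrite /simplex pE.
move=> /andP[/forallP bv]; rewrite pE => pr.
set i := (r^-1 on)%g in bv *; set v0 := shift_down v i in bv *.
have vertexE j : j <= n ->
    kuhn_vertex v0 (r * s^-1)%g j.+1 = kuhn_vertex v r j.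
  move=> jn; apply/funext => c; rewrite /kuhn_vertex.
  set r0 := (r * s^-1)%g; have rE : r = (r0 * s)%g by rewrite /r0 mulgKV.
  have rc : r c = s (r0 c) by rewrite rE permM.
  have ci : (c == i) = (r c == n :> nat).
    apply/eqP/eqP => [->|rcn]; first by rewrite /i permKV.
    by apply: (@perm_inj _ r); rewrite /i permKV; apply/ord_inj.
  have := bv c; rewrite /v0 shift_downE ci rc.
  have [r0n|r0n] := leqP (r0 c) n; last first.
    rewrite (perm_on_low ps r0n) (gtn_eqF r0n) => _.
    by lia.
  rewrite (sE _ r0n); have vN : v c < N.+1 by [].
  (* The direction of rank 0 in [r0] is [i]: its step, taken before vertex j+1, restores the unit
     removed by [shift_down], and [base] excludes the wrap-around. The other ranks up to n drop by
     one. *)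
  have [r00|r00] := eqVneq (r0 c : nat) 0.
    rewrite r00 eqxx; have cn : c < n.+1.
      rewrite ltnNge; apply/negP => nc; move: r00 r0n.
      have rcc := perm_on_low pr nc.
      have : s (r0 c) = c by rewrite -rc.
      move=> /(congr1 (@nat_of_ord _)) + r00; rewrite sE ?r00 // eqxx; lia.
    rewrite cn; case: ifP; lia.
  by rewrite (_ : (_.-1 == n) = false); [lia|apply/eqP; lia].
apply/almostP/onto_labelsP => H l ln; have := H l ln.
  move=> [[|j] [jn //= _ wj]]; exists j => //.
  by rewrite -vertexE.
move=> [j jn wj]; exists j.+1; split => //.
by rewrite vertexE.
Qed.

(* The two outer facet sums cancel except on the two faces orthogonal to the last
   direction i; there label i is missing when v i = N, and labels are at most i
   when v i = 0. *)
Lemma complete_boundary n (nd : n < d) v r : perm_on (low n.+1) r ->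
  (base n.+1 v (+) base n.+1 (shift_down v (r^-1 (Ordinal nd))%g)) &&
    complete n v r =
  simplex n v r && complete n v r.
Proof.
set on := Ordinal nd; set i := (r^-1 on)%g => pr.
have [/onto_labelsP cvr|] := boolP (complete n v r); last by rewrite !andbF.
rewrite !andbT.
have ri : r i = on by rewrite /i permKV.
have i_n : i <= n.
  rewrite leqNgt; apply/negP => ni.
  by have e := perm_on_low pr ni; move: ni; rewrite -e ri ltnn.
have xi j : j <= n -> kuhn_vertex v r j i = v i.
  by move=> jn; rewrite /kuhn_vertex ri /= ltnNge jn addn0.
(* If N were 0, the origin would lie on both opposite faces of direction 0: [lab0] forces label 0
   there and [labN] forbids it. *)
have N0 : 0 < N.
  rewrite lt0n; apply/eqP => N0.
  have d0 : 0 < d by lia.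
  have := labN (x := fun=> 0) (i := Ordinal d0) (esym N0).
  by have := lab0 (x := fun=> 0) (i := Ordinal d0) erefl; rewrite leqn0 => ->.
have viN : v i != N :> nat.
  apply/eqP => viN; have [j jn lj] := cvr i i_n.
  have := labN (x := kuhn_vertex v r j) (i := i).
  by rewrite lj eqxx xi // => /(_ viN).
have vi0 : v i = 0 :> nat -> i = n :> nat.
  move=> vi0; have [j jn lj] := cvr n (leqnn n).
  have := lab0 (x := kuhn_vertex v r j) (i := i).
  by rewrite xi // lj => /(_ vi0); lia.
have viN' : v i < N by have := ltn_ord (v i); lia.
(* If [v i] is positive, both cells are admissible and cancel, while [(v, r)] is no n-simplex: that
   would need i = n and [v i] = 0. If [v i] = 0, the shifted corner wraps around to N and only the
   first term remains. *)
have [v0|v0] := eqVneq (v i : nat) 0; last first.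
  rewrite (_ : base _ (shift_down _ _) = base n.+1 v); last first.
    apply: eq_forallb => c; rewrite shift_downE; case: eqVneq => // ->.
    by rewrite (negbTE v0) ltnS i_n; lia.
  rewrite addbb; apply/esym/negbTE/negP => /andP[/forallP bv prn].
  have iE : i = on by apply: (@perm_inj _ r); rewrite ri (perm_on_low prn).
  by have := bv on; rewrite -iE iE ltnn -iE (negbTE v0).
rewrite (_ : base _ (shift_down _ _) = false) ?addbF; last first.
  by apply/negbTE/negP => /forallP /(_ i); rewrite shift_downE eqxx v0 eqxx ltnS i_n ltnn.
have iE : i = on by apply/ord_inj; rewrite (vi0 v0).
rewrite /simplex (_ : perm_on (low n) r) ?andbT; last first.
  apply/fintype.subsetP => c; rewrite inE => rc.
  have : c \in low n.+1 by apply: (fintype.subsetP pr); rewrite inE.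
  rewrite !inE ltnS leq_eqVlt => /orP[/eqP cn|//].
  by move: rc; rewrite (_ : c = on) -?iE ?ri ?iE ?eqxx //; apply/ord_inj.
apply: eq_forallb => c; rewrite ltnS leq_eqVlt.
have [cn|//] := eqVneq (c : nat) n.
have -> : c = i by rewrite iE; apply/ord_inj.
by rewrite viN' vi0 // ltnn v0.
Qed.

Lemma almost_last n (w : nat -> nat) : almost n w n.+1 = onto_labels n w.
Proof.
apply/almostP/onto_labelsP => H l ln.
  by have [j [jn jl wj]] := H l ln; exists j => //; lia.
by have [j jn wj] := H l ln; exists j; split => //; lia.
Qed.

(** Induction on the dimension. It starts at the origin, whose label is 0 by [lab0], or by [lab_le]
    when d = 0. *)
Lemma complete_parity n : n <= d ->
  \big[addb/false]_(p : {ffun 'I_d -> 'I_N.+1} * 'S_d | simplex n p.1 p.2)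
    complete n p.1 p.2.
Proof.
elim: n => [_|n IHn nd].
  rewrite (big_pred1 ([ffun=> ord0], 1%g)); last first.
    move=> [v r] /=; rewrite /simplex xpair_eqE; congr (_ && _).
      apply/forallP/eqP => [bv|-> c]; last by rewrite /= ffunE.
      by apply/ffunP => c; apply/ord_inj; rewrite ffunE; apply/eqP; exact: (bv c).
    rewrite (_ : low 0 = finset.set0); last by apply/finset.setP => c; rewrite !inE.
    apply/idP/eqP => [pr|->]; last exact: perm_on1.
    by apply/permP => c; rewrite perm1 (out_perm pr) ?inE.
  apply/onto_labelsP => l; rewrite leqn0 => /eqP ->; exists 0 => //=.
  apply/eqP; rewrite -leqn0; have [d0|d0] := posnP d.
    by rewrite -[X in _ <= X]d0.
  by apply: (lab0 (i := Ordinal d0)); rewrite /kuhn_vertex ffunE ltn0.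
(* Each simplex contributes the parity of its doors. After exchanging the sums, the doors with 0 < k
   <= n cancel; those opposite vertices 0 and n+1 combine, by [complete_boundary], into the count
   for dimension n. *)
rewrite (eq_bigr _ (fun p => @complete_almost n p.1 p.2)) exchange_big /=.
rewrite big_ord_recl big_ord_recr /= [X in _ (+) (X (+) _)]big1 ?addFb; last first.
  by move=> k _; apply: inner_facets => //=; rewrite ltn_ord.
rewrite (outer_facets nd) big_mkcond /= [X in _ (+) X]big_mkcond -big_split /=.
apply: (etrans _ (IHn (ltnW nd))); rewrite [RHS]big_mkcond /=; apply: eq_bigr => -[v r] _ /=.
have [pr|pr] := boolP (perm_on (low n.+1) r); last first.
  rewrite /simplex (negbTE pr) !andbF; case: ifP => // /andP[_ prn].
  case/negP: pr; apply: (fintype.subset_trans prn); apply/fintype.subsetP => c.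
  by rewrite !inE => /leqW.
rewrite (almost_last n) -/(complete n v r).
have := complete_boundary nd v pr; rewrite /simplex pr !andbT.
by rewrite andb_addl addbC.
Qed.

(** An odd count is not zero. Of the simplex found for n = d only its cell is kept, since closeness
    of the d+1 points is what matters later. *)
Lemma kuhn_lemma : exists (v : 'I_d -> nat) (x : 'I_d.+1 -> 'I_d -> nat),
  [/\ forall c, v c < N, forall l c, v c <= x l c <= (v c).+1 &
      forall l, lab (x l) = l].
Proof.
have := complete_parity (leqnn d).
have [[[v r] /= /andP[/andP[/forallP bv _] /onto_labelsP cvr]] _|H] :=
  pselect (exists p : {ffun 'I_d -> 'I_N.+1} * 'S_d,
             simplex d p.1 p.2 && complete d p.1 p.2); last first.
  rewrite big1 // => p sp; apply/negbTE/negP => cp; apply: H.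
  by exists p; rewrite sp cp.
have /choice[f fP] : forall l : 'I_d.+1, exists j, lab (kuhn_vertex v r j) = l.
  by move=> l; have [|j _ wj] := cvr l; [rewrite -ltnS ltn_ord|exists j].
exists (fun c => v c), (fun l => kuhn_vertex v r (f l)); split => //.
  by move=> c; have := bv c; rewrite ltn_ord.
by move=> l c; rewrite /kuhn_vertex; case: (r c < f l); rewrite ?addn0 ?addn1 leqnn leqnSn.
Qed.
End kuhn_triangulation.

Import Order.TTheory GRing.Theory Num.Theory.
Import numFieldNormedType.Exports.
Local Open Scope classical_set_scope.
Local Open Scope ring_scope.
Local Open Scope ereal_scope.

(** * Stability of the output distribution *)

(** For probabilities, passing to complements shows that this is total variation distance at most
    [eta]; the one-sided form avoids signed measures. *)
Definition dominated_up_to d (T : measurableType d) (R : realType)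
    (eta : R) (P Q : set T -> \bar R) : Prop :=
  forall B, measurable B -> P B <= Q B + eta%:E.

Lemma integral_le_up_to d (T : measurableType d) (R : realType)
    (P : probability T R) (f g : T -> \bar R) (eta : R) : (0 <= eta)%R ->
  measurable_fun setT f -> measurable_fun setT g ->
  (forall x, 0 <= f x) -> (forall x, 0 <= g x) ->
  (forall x, f x <= g x + eta%:E) ->
  \int[P]_x f x <= \int[P]_x g x + eta%:E.
Proof.
move=> eta0 mf mg f0 g0 fg.
have -> : eta%:E = \int[P]_x (cst eta%:E x).
  by rewrite integral_cst // [X in _ * X](probability_setT P) mule1.
rewrite -ge0_integralD //.
apply: ge0_le_integral => //.
exact: emeasurable_funD.
Qed.

Section product.
Context d1 d2 (T1 : measurableType d1) (T2 : measurableType d2) (R : realType).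
Implicit Types (P Q : probability T1 R) (S : probability T2 R) (eta : R).

(** [\x] integrates over the first factor; [dominated_prodl] compares sections in the first factor
    and so integrates over the second. *)
Lemma product_measure12 P S B : measurable B -> (P \x S) B = (P \x^ S) B.
Proof.
move=> mB; apply: (product_measure_unique (m' := (P \x^ S))) => // A1 A2 mA1 mA2.
exact: product_measure2E.
Qed.

Lemma dominated_prodl P Q S eta : (0 <= eta)%R ->
  dominated_up_to eta P Q -> dominated_up_to eta (P \x S) (Q \x S).
Proof.
move=> eta0 PQ B mB; rewrite !product_measure12 //.
apply: integral_le_up_to => //.
- exact: measurable_fun_ysection.
- exact: measurable_fun_ysection.
- by move=> y; apply: PQ; exact: measurable_ysection.
Qed.

Lemma dominated_prodr P Q S eta : (0 <= eta)%R ->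
  dominated_up_to eta P Q -> dominated_up_to eta (S \x P) (S \x Q).
Proof.
move=> eta0 PQ B mB; apply: integral_le_up_to => //.
- exact: measurable_fun_xsection.
- exact: measurable_fun_xsection.
- by move=> y; apply: PQ; exact: measurable_xsection.
Qed.

End product.

Lemma dominated_trans d (T : measurableType d) (R : realType) (e1 e2 : R)
    (P Q S : set T -> \bar R) :
  dominated_up_to e1 P Q -> dominated_up_to e2 Q S -> dominated_up_to (e1 + e2) P S.
Proof.
move=> PQ QS B mB; apply: (le_trans (PQ _ mB)).
by rewrite EFinD (addeC e1%:E) addeA leeD2r // QS.
Qed.

(** Hybrid argument: the coordinates are replaced one at a time, each at cost [eta]. *)
Lemma dominated_power_prob d (T : measurableType d) (R : realType)
    (P Q : probability T R) (eta : R) n : (0 <= eta)%R ->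
  dominated_up_to eta P Q -> dominated_up_to (n%:R * eta) (power_prob P n) (power_prob Q n).
Proof.
move=> eta0 PQ; elim: n => [|n IHn].
  by move=> B mB /=; rewrite mul0r adde0.
move=> B mB /=; rewrite /distribution /pushforward.
have : dominated_up_to (n.+1%:R * eta) (P \x power_prob P n) (Q \x power_prob Q n).
  rewrite -natr1 mulrDl mul1r addrC.
  apply: dominated_trans (dominated_prodl (power_prob P n) eta0 PQ) _.
  by apply: dominated_prodr => //; rewrite mulr_ge0.
apply; rewrite -[X in measurable X]setTI.
exact: (measurable_cons).
Qed.

Lemma measurable_disagreement d (X : measurableType d) (f g : {mfun X >-> bool}) :
  measurable [set x | f x <> g x].
Proof.
have mT (h : {mfun X >-> bool}) : measurable (h @^-1` [set true]).
  by rewrite -[X in measurable X]setTI; exact: measurable_funPT.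
rewrite (_ : [set _ | _] =
  (f @^-1` [set true] `\` g @^-1` [set true]) `|`
  (g @^-1` [set true] `\` f @^-1` [set true])).
  by apply: measurableU; exact: measurableD.
by apply/seteqP; split => x /=; case: (f x); case: (g x) => //=; intuition.
Qed.

(** The labelled examples for [f] and [g] coincide outside the disagreement set. *)
Lemma dominated_example_dist d (X : measurableType d) (R : realType)
    (D : probability X R) (f g : {mfun X >-> bool}) (eta : R) :
  error D f g <= eta%:E ->
  dominated_up_to eta (example_dist D f) (example_dist D g).
Proof.
move=> fg B mB; rewrite /= /distribution /pushforward.
have mP (h : {mfun X >-> bool}) : measurable (labelled h @^-1` B).
  by rewrite -[X in measurable X]setTI; exact: measurable_funPT.
have mfg := measurable_disagreement f g.
apply: (@le_trans _ _ (D (labelled g @^-1` B `|` [set x | f x <> g x]))).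
  apply: le_measure; rewrite ?inE; first exact: mP.
    by apply: measurableU; [exact: mP|exact: mfg].
  move=> x /= Bx; have [fgx|] := eqVneq (f x) (g x).
    by left; rewrite /labelled -fgx.
  by move=> /eqP; right.
apply: (le_trans (measureU2 _ (mP g) mfg)).
by rewrite leeD2l.
Qed.

Lemma measure_bigsetU_le d (T : measurableType d) (R : realType)
    (mu : {measure set T -> \bar R}) (I : Type) (s : seq I) (F : I -> set T) :
  (forall i, measurable (F i)) ->
  mu (\big[setU/set0]_(i <- s) F i) <= \sum_(i <- s) mu (F i).
Proof.
move=> mF; elim: s => [|i s IHs]; first by rewrite !big_nil measure0.
rewrite !big_cons; apply: (le_trans (measureU2 _ (mF i) _)).
  exact: bigsetU_measurable.
by rewrite leeD2l.
Qed.

Lemma error_triangle d (X : measurableType d) (R : realType)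
    (D : probability X R) (f g h : {mfun X >-> bool}) :
  error D f g <= error D f h + error D g h.
Proof.
have mfh := measurable_disagreement f h; have mgh := measurable_disagreement g h.
apply: le_trans (measureU2 _ mfh mgh).
apply: le_measure; rewrite ?inE; first exact: measurable_disagreement.
  exact: measurableU.
by move=> x /=; case: (f x); case: (g x); case: (h x) => //=; intuition.
Qed.

(** * Output probabilities and finite lists *)

Section finite_output.
Context d (T : measurableType d) (R : realType) (P : probability T R).
Context (K : eqType) (out : T -> K).
Hypothesis mout : forall h, measurable [set z | out z = h].

Lemma output_inE (L : seq K) :
  [set z | out z \in L] = \big[setU/set0]_(h <- L) [set z | out z = h].
Proof.
elim: L => [|h L IHL]; first by rewrite big_nil; apply/seteqP; split.
rewrite big_cons -IHL; apply/seteqP; split => z /=; rewrite inE.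
  by move=> /orP[/eqP|]; [left|right].
by move=> [->|->]; rewrite ?eqxx ?orbT.
Qed.

Lemma measurable_output_in (L : seq K) : measurable [set z | out z \in L].
Proof. by rewrite output_inE; exact: bigsetU_measurable. Qed.

(** Pigeonhole by the union bound over at most [k] outputs. *)
Lemma likely_output (L : seq K) (k : nat) (delta : R) : (0 < k)%N ->
  (size L <= k)%N -> (delta < 1)%R -> (1 - delta)%:E <= P [set z | out z \in L] ->
  exists2 h, h \in L & ((1 - delta) / k%:R)%:E <= P [set z | out z = h].
Proof.
move=> k0 sL d1 PL; apply: contrapT => H.
have {}H h : h \in L -> P [set z | out z = h] < ((1 - delta) / k%:R)%:E.
  by move=> hL; rewrite ltNge; apply/negP => Ph; apply: H; exists h.
have : P [set z | out z \in L] <= \sum_(h <- L) P [set z | out z = h].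
  by rewrite output_inE; exact: measure_bigsetU_le.
have c0 : (0 < (1 - delta) / k%:R)%R by rewrite divr_gt0 ?subr_gt0 ?ltr0n.
(* The union bound is strict only for a nonempty list; an empty one contradicts delta < 1. *)
case: L sL PL H => [|h0 L] sL PL H.
  rewrite big_nil => P0; have := le_trans PL P0.
  by rewrite lee_fin leNgt subr_gt0 d1.
move=> P1; have := le_trans PL P1; apply/negP; rewrite -ltNge.
rewrite big_cons; apply: (@lt_le_trans _ _
  (((1 - delta) / k%:R)%:E + \sum_(h <- L) ((1 - delta) / k%:R)%:E)).
  apply: lte_leD; rewrite ?H ?mem_head //.
    by apply/sum_fin_numP => h _ _; exact: fin_num_measure.
  rewrite [leLHS]big_seq [leRHS]big_seq; apply: lee_sum => h hL.
  by rewrite ltW // H // in_cons hL orbT.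
rewrite sumEFin -EFinD lee_fin big_const_seq count_predT iter_addr_0 -mulrS.
rewrite -[X in (X <= _)%R]mulr_natr mulrAC ler_pdivrMr ?ltr0n // ler_pM2l ?subr_gt0 // ler_nat.
exact: sL.
Qed.

(** Such an output lies in the exceptional event. Used contrapositively: an output of probability
    above [delta] must be listed. *)
Lemma unlikely_output (L : seq K) (delta : R) h : h \notin L ->
  (1 - delta)%:E <= P [set z | out z \in L] -> P [set z | out z = h] <= delta%:E.
Proof.
move=> hL PL.
apply: (@le_trans _ _ (P (~` [set z | out z \in L]))).
  apply: le_measure; rewrite ?inE //.
    by apply: measurableC; exact: measurable_output_in.
  by move=> z /= -> ; apply/negP.
rewrite probability_setC; last exact: measurable_output_in.
rewrite leeBlDr; last exact/fin_num_measure/measurable_output_in.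
apply: le_trans (leeD2l delta%:E PL).
by rewrite -EFinD addrC subrK.
Qed.

End finite_output.

(** * Thresholds under the uniform distribution *)

Section cube_volume.
Variables (R : realType) (d : nat).
Local Notation I := (unit_interval R).
Local Notation D := (uniform_cube R d).

Lemma measurable_unit_itv (a b : R) : measurable [set x : I | (a < val x <= b)%R].
Proof.
exists `]a, b]%classic; first exact: measurable_itv.
by rewrite setTI; apply/seteqP; split => x; rewrite /= in_itv.
Qed.

Lemma uniform01_itv (a b : R) : (0 <= a <= b)%R -> (b <= 1)%R ->
  uniform01 [set x : I | (a < val x <= b)%R] = (b - a)%:E.
Proof.
move=> /andP[a0 ab] b1.
rewrite /uniform01 (_ : [set x : I | _] = (\val : I -> R) @^-1` `]a, b]); last first.
  by apply/seteqP; split => x; rewrite /= in_itv.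
rewrite image_unit_val (_ : _ `&` _ = `]a, b]%classic).
  rewrite lebesgue_measure_itv /= lte_fin; case: ltP => // ba.
  by rewrite (_ : b - a = 0)%R //; apply/eqP; rewrite subr_eq0 eq_le ba ab.
apply/seteqP; split => x /=; rewrite !in_itv /=; first by case.
move=> /andP[ax xb]; split; first by rewrite ax xb.
by rewrite (le_trans a0 (ltW ax)) (le_trans xb b1).
Qed.

Lemma measurable_slab (i : 'I_d) (B : set I) : measurable B ->
  measurable [set x : cube R d | B (tnth x i)].
Proof.
by move=> mB; rewrite -[X in measurable X]setTI; exact: measurable_tnth.
Qed.

Lemma uniform_cube_slab (i : 'I_d) (B : set I) : measurable B ->
  D [set x : cube R d | B (tnth x i)] = uniform01 B.
Proof.
move=> mB; pose A j := if j == i then B else [set: I].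
rewrite (_ : [set x | _] = [set x : cube R d | forall j, A j (tnth x j)]); last first.
  apply/seteqP; split => x /=; last by move=> /(_ i); rewrite /A eqxx.
  by move=> Bx j; rewrite /A; case: eqP => [->|].
rewrite /uniform_cube power_prob_box; last by move=> j; rewrite /A; case: ifP.
rewrite (bigD1 i) //= /A eqxx big1 ?mule1 // => j /negbTE ->.
exact: probability_setT.
Qed.

(** Where the thresholds disagree, some coordinate lies between those of [t] and [s]: a union of d
    slabs of width at most [e]. *)
Lemma threshold_error_le (t s : cube R d) (e : R) :
  (forall i, (`|val (tnth t i) - val (tnth s i)| <= e)%R) ->
  error D (threshold t) (threshold s) <= (d%:R * e)%:E.
Proof.
move=> ts.
pose lo i := Num.min (val (tnth t i)) (val (tnth s i)).
pose hi i := Num.max (val (tnth t i)) (val (tnth s i)).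
pose F i := [set x : cube R d | [set y : I | (lo i < val y <= hi i)%R] (tnth x i)].
have mF i : measurable (F i).
  exact: (measurable_slab i (measurable_unit_itv (lo i) (hi i))).
apply: (@le_trans _ _ (D (\big[setU/set0]_(i <- enum 'I_d) F i))).
  apply: le_measure; rewrite ?inE; first exact: measurable_disagreement.
    exact: bigsetU_measurable.
  move=> x /= tsx.
  have [i Fi] : exists i, F i x.
    apply: contrapT => noF; apply: tsx; apply: eq_forallb => i.
    apply/idP/idP => xi; rewrite leNgt; apply/negP => xi'; apply: noF; exists i;
      by rewrite /F /= /lo /hi gt_min le_max xi xi' ?orbT.
  by rewrite -bigcup_seq; exists i => //=; rewrite mem_enum.
apply: (le_trans (measure_bigsetU_le _ _ mF)).
apply: (@le_trans _ _ (\sum_(i <- enum 'I_d) e%:E)); last first.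
  rewrite sumEFin lee_fin big_const_seq count_predT size_enum_ord iter_addr_0.
  by rewrite mulr_natl.
apply: lee_sum => i _.
rewrite [X in X <= _](uniform_cube_slab i (measurable_unit_itv (lo i) (hi i))).
have := svalP (tnth t i); have := svalP (tnth s i).
move=> /andP[s0 s1] /andP[t0 t1].
rewrite uniform01_itv ?lee_fin.
- have := ts i; rewrite /lo /hi; case: (leP (val (tnth t i)) (val (tnth s i))) => tsi.
    by rewrite distrC ger0_norm // subr_ge0.
  by rewrite ger0_norm // subr_ge0 ltW.
- by rewrite /lo /hi le_min t0 s0 ge_min !le_max lexx.
- by rewrite /hi ge_max t1 s1.
Qed.

Lemma threshold_error_ge (t s : cube R d) (i : 'I_d) :
  (forall j, 2^-1 <= val (tnth t j))%R -> (forall j, 2^-1 <= val (tnth s j))%R ->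
  val (tnth t i) = 2^-1%R -> val (tnth s i) = 1%R ->
  ((2^-1) ^+ d)%:E <= error D (threshold t) (threshold s).
Proof.
move=> t2 s2 ti si.
(* The thresholds disagree on the box with i-th side ]1/2,1] and other sides ]0,1/2]. *)
pose A j := if j == i then [set y : I | (2^-1 < val y <= 1)%R]
            else [set y : I | (0 < val y <= 2^-1)%R].
have mA j : measurable (A j).
  by rewrite /A; case: ifP => _; exact: measurable_unit_itv.
have half1 : (2^-1 <= 1 :> R)%R by rewrite invf_le1 ?ler1n.
have half0 : (0 <= 2^-1 :> R)%R by rewrite invr_ge0.
have <- : D [set x : cube R d | forall j, A j (tnth x j)] = ((2^-1) ^+ d)%:E.
  rewrite /uniform_cube power_prob_box // (eq_bigr (fun=> (2^-1)%:E)).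
    by rewrite prodEFin prodr_const card_ord.
  move=> j _; rewrite /A; case: ifP => _.
    apply: (etrans (uniform01_itv _ _)); rewrite ?half0 ?lexx //.
    by rewrite [X in (X - _)%R](splitr 1%R) mul1r addrK.
  by apply: (etrans (uniform01_itv _ _)); rewrite ?half0 ?lexx ?subr0.
have mbox : measurable [set x : cube R d | forall j, A j (tnth x j)].
  rewrite (_ : [set _ | _] = \bigcap_(j in [set: 'I_d])
      [set x : cube R d | A j (tnth x j)]).
    by apply: fin_bigcap_measurable => // j _; exact: measurable_slab.
  by apply/seteqP; split=> x Ax j; [move=> _; exact: Ax|exact: (Ax j Logic.I)].
apply: le_measure; rewrite ?inE //; first exact: measurable_disagreement.
move=> x /= Ax.
have Axi : (2^-1 < val (tnth x i) <= 1)%R by have := Ax i; rewrite /A eqxx.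
have -> : threshold t x = false.
  apply/negbTE/forallPn; exists i; rewrite -ltNge ti.
  by case/andP: Axi.
have -> : threshold s x = true.
  apply/forallP => j; have := Ax j; rewrite /A; case: eqP => [-> /andP[_]|_ /andP[_ xj]].
    by rewrite si.
  exact: le_trans xj (s2 j).
by [].
Qed.

End cube_volume.

(** * Colouring a grid of [1/2,1]^d *)

Section grid.
Variables (R : realType) (d N : nat).
Local Open Scope ring_scope.

(** Truncating at N defines grid points for all natural coordinates, as the labelling in
    [kuhn_lemma] is total. *)
Lemma grid_coord_subproof (j : nat) :
  (0 <= (1 + (minn j N)%:R / N%:R) / 2 :> R) && ((1 + (minn j N)%:R / N%:R) / 2 <= 1 :> R).
Proof.
have q0 : 0 <= (minn j N)%:R / N%:R :> R by rewrite divr_ge0.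
have q1 : (minn j N)%:R / N%:R <= 1 :> R.
  have [->|N0] := posnP N; first by rewrite invr0 mulr0.
  by rewrite ler_pdivrMr ?ltr0n // mul1r ler_nat geq_minr.
by rewrite divr_ge0 ?addr_ge0 //= ler_pdivrMr // mul1r -[2]/(1 + 1) lerD2l.
Qed.

Definition grid_coord (j : nat) : unit_interval R :=
  exist _ ((1 + (minn j N)%:R / N%:R) / 2) (grid_coord_subproof j).

Definition grid_point (x : 'I_d -> nat) : cube R d :=
  [tuple grid_coord (x i) | i < d].

Lemma grid_pointE x i :
  val (tnth (grid_point x) i) = (1 + (minn (x i) N)%:R / N%:R) / 2.
Proof. by rewrite tnth_mktuple. Qed.

Lemma grid_point_ge x i : 2^-1 <= val (tnth (grid_point x) i).
Proof. by rewrite grid_pointE ler_pdivlMr // mulVf ?pnatr_eq0 // lerDl divr_ge0. Qed.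

Lemma grid_point_lo x i : x i = 0%N -> val (tnth (grid_point x) i) = 2^-1.
Proof. by move=> xi; rewrite grid_pointE xi min0n mul0r addr0 mul1r. Qed.

Lemma grid_point_hi x i : (0 < N)%N -> x i = N -> val (tnth (grid_point x) i) = 1.
Proof.
by move=> N0 xi; rewrite grid_pointE xi minnn !divff ?pnatr_eq0 -?lt0n.
Qed.

Lemma grid_point_near x y (i : 'I_d) (v : nat) :
  (v <= x i <= v.+1)%N -> (v <= y i <= v.+1)%N ->
  `|val (tnth (grid_point x) i) - val (tnth (grid_point y) i)| <= (2 * N%:R)^-1.
Proof.
move=> xv yv; rewrite !grid_pointE.
set a := minn (x i) N; set b := minn (y i) N.
have -> : (1 + a%:R / N%:R) / 2 - (1 + b%:R / N%:R) / 2 =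
    (a%:R - b%:R) * (2 * N%:R)^-1 :> R.
  by rewrite invfM -mulrBl opprD addrACA subrr add0r -mulrBl mulrAC mulrA.
rewrite normrM [`|(2 * _)^-1|]ger0_norm ?invr_ge0 ?mulr_ge0 // ler_piMl ?invr_ge0 ?mulr_ge0 //.
rewrite {}/a {}/b.
wlog xy : x y xv yv / (minn (y i) N <= minn (x i) N)%N.
  by move=> H; case/orP: (leq_total (minn (y i) N) (minn (x i) N)) => /H;
     [apply|rewrite distrC; apply].
by rewrite -natrB // normr_nat lern1; lia.
Qed.

End grid.

Section coloring.
Local Open Scope ring_scope.
Variables (R : realType) (d N : nat) (eps : R).
Hypothesis N0 : (0 < N)%N.
Hypothesis eps_small : eps + eps < (2^-1) ^+ d.
Local Notation D := (uniform_cube R d).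
Local Notation hyp := {mfun cube R d >-> bool}.
Variable col : ('I_d -> nat) -> hyp.
Hypothesis colP : forall x, approximate D (threshold (grid_point R N x)) eps (col x).

Definition near_low_face (h : hyp) (i : 'I_d) : Prop :=
  exists t : cube R d, [/\ forall j, 2^-1 <= val (tnth t j),
    val (tnth t i) = 2^-1 & approximate D (threshold t) eps h].

(** The label is a function of the hypothesis alone, so different labels give different colours in
    [rainbow_cell]. *)
Definition label (h : hyp) : nat :=
  find (fun i => `[< near_low_face h i >]) (enum 'I_d).

Lemma label_lo x (i : 'I_d) : x i = 0%N -> (label (col x) <= i)%N.
Proof.
move=> xi; rewrite leqNgt; apply/negP => /(before_find i).
rewrite nth_ord_enum => /asboolP; apply.
exists (grid_point R N x); split; [|exact: grid_point_lo|exact: colP].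
by move=> j; exact: grid_point_ge.
Qed.

(** Otherwise, by the triangle inequality through [col x], two thresholds at distance at least 2^-d
    would be within 2 eps. *)
Lemma label_hi x (i : 'I_d) : x i = N -> label (col x) != i.
Proof.
move=> xi; apply/eqP => li.
have hasi : has (fun i => `[< near_low_face (col x) i >]) (enum 'I_d).
  by rewrite has_find -/(label _) li size_enum_ord.
have := nth_find i hasi; rewrite -/(label _) li nth_ord_enum => /asboolP[t [t2 ti ht]].
have := threshold_error_ge t2 (grid_point_ge R N x) ti (grid_point_hi R N0 xi).
apply/negP; rewrite -ltNge; apply: le_lt_trans (error_triangle _ _ _ (col x)) _.
apply: le_lt_trans (leeD ht (colP x)) _.
by rewrite -EFinD lte_fin.
Qed.

Lemma rainbow_cell : exists (v : 'I_d -> nat) (x : 'I_d.+1 -> 'I_d -> nat),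
  (forall l c, (v c <= x l c <= (v c).+1)%N) /\ injective (fun l => col (x l)).
Proof.
have [|v [x [_ vx lx]]] := kuhn_lemma (lab := fun x => label (col x)) _ label_lo label_hi.
  by move=> x; rewrite -[leqRHS](size_enum_ord d) find_size.
exists v, x; split => // a b ab; apply/ord_inj.
by rewrite -(lx a) -(lx b) ab.
Qed.

End coloring.

(** * Choice of the grid size and the final count *)

Section perturbation.
Local Open Scope ring_scope.

Lemma perturbed_output_prob (R : realType) (d : nat)
    (A : randomized_algorithm (cube R d) R) (delta eps e : R) (m : nat)
    (s t : cube R d) (h : {mfun cube R d >-> bool}) : 0 <= e ->
  (forall i, `|val (tnth s i) - val (tnth t i)| <= e) ->
  ((power_prob (example_dist (uniform_cube R d) (threshold s)) m \x coins_prob A)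
     [set z | run A delta eps z.1 z.2 = h] <=
   (power_prob (example_dist (uniform_cube R d) (threshold t)) m \x coins_prob A)
     [set z | run A delta eps z.1 z.2 = h] + (m%:R * (d%:R * e))%:E)%E.
Proof.
move=> e0 st.
have de0 : 0 <= d%:R * e by rewrite mulr_ge0.
have st' : dominated_up_to (m%:R * (d%:R * e))
    (power_prob (example_dist (uniform_cube R d) (threshold s)) m)
    (power_prob (example_dist (uniform_cube R d) (threshold t)) m).
  apply: dominated_power_prob => //.
  by apply: dominated_example_dist; exact: threshold_error_le.
apply: (dominated_prodl (coins_prob A) _ st' (measurable_run A delta eps h)).
by rewrite mulr_ge0.
Qed.

(** With delta = 1/(k+2), the number (1-delta)/k exceeds delta by exactly 1/(k(k+2)). For N =
    mdk(k+2)+1 the perturbation md/(2N) is less than half of that. *)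
Lemma error_gap (R : realFieldType) (m d k : nat) : (0 < k)%N ->
  (k + 2)%:R^-1 + m%:R * (d%:R * (2 * (m * d * k * (k + 2)).+1%:R)^-1)
    < (1 - (k + 2)%:R^-1) / k%:R :> R.
Proof.
move=> k0; rewrite -subr_gt0 -[(_ * _ * _ * _).+1]addn1 !natrD !natrM natrD.
have : 0 < k%:R :> R by rewrite ltr0n.
have : 0 <= m%:R :> R by []; have : 0 <= d%:R :> R by [].
move: (m%:R) (d%:R) (k%:R) => {m d k k0} m d k d0 m0 k0.
have P0 : 0 <= m * d * k * (k + 2) 
  by do !apply: mulr_ge0 => //; [exact: ltW|exact: addr_ge0 (ltW k0) _].
have k2 : 0 < k + 2 by rewrite addr_gt0.
rewrite (_ : _ - _ = (m * d * k * (k + 2) + 2) /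
    (2 * (m * d * k * (k + 2) + 1) * (k * (k + 2)))); last first.
  field.
  by rewrite !gt_eqF // ltr_wpDl.
by rewrite divr_gt0 ?ltr_wpDl // !mulr_gt0 // ltr_wpDl.
Qed.

End perturbation.

Theorem theorem5p12 (R : realType) (d : nat) (hd : (1 <= d)%N)
    (k : nat) (hk0 : (0 < k)%N) (hk : (k < d.+1)%N) :
  ~ exists A : randomized_algorithm (cube R d) R,
      list_replicable (uniform_cube R d) threshold_class k A.
Proof.
move=> [A hA].
(* This makes 2 eps = 2^-(d+1), below the distance 2^-d of [threshold_error_ge]. *)
pose eps : R := (2^-1 ^+ d.+2)%R; pose delta : R := ((k + 2)%:R^-1)%R.
have eps0 : (0 < eps)%R by rewrite exprn_gt0 // invr_gt0.
have eps1 : (eps < 1)%R by rewrite exprn_ilt1 // ?invr_ge0 // invf_lt1 // ltr1n.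
have delta0 : (0 < delta)%R by rewrite invr_gt0 ltr0n addn2.
have delta1 : (delta < 1)%R by rewrite invf_lt1 ?ltr0n ?ltr1n addn2.
have [| |m hm] := hA eps delta; rewrite ?eps0 ?delta0 ?(ltW delta1) //.
(* [m] is fixed before the target is, so the grid may be refined in terms of [m]. *)
pose N := (m * d * k * (k + 2)).+1.
pose p t := (power_prob (example_dist (uniform_cube R d) (threshold t)) m
              \x coins_prob A).
pose out (z : m.-tuple (cube R d * bool) * coins A) := run A delta eps z.1 z.2.
have mout h : measurable [set z | out z = h] by exact: measurable_run.
have /choice[L LP] : forall t : cube R d, exists L : seq {mfun cube R d >-> bool},
   [/\ (size L <= k)%N,
       forall h, h \in L -> approximate (uniform_cube R d) (threshold t) eps h
     & (1 - delta)%:E <= p t [set z | out z \in L]].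
  by move=> t; apply: hm; exists t.
have /choice[best bestP] t : exists h, h \in L t /\
    ((1 - delta) / k%:R)%:E <= p t [set z | out z = h].
  have [sL _ pL] := LP t.
  by have [h hL ph] := likely_output mout hk0 sL delta1 pL; exists h.
have eps2 : (eps + eps < 2^-1 ^+ d)%R.
  rewrite /eps !exprS; set q := (2^-1 ^+ d)%R.
  have q0 : (0 < q)%R by rewrite exprn_gt0 // invr_gt0.
  by lra.
have bestA y : approximate (uniform_cube R d) (threshold (grid_point R N y)) eps
    (best (grid_point R N y)).
  have [_ + _] := LP (grid_point R N y); apply.
  by have [] := bestP (grid_point R N y).
have [v [x [vx inj]]] := rainbow_cell (ltn0Sn _) eps2 bestA.
(* Any vertex of the cell would do: each colour is likely at its own vertex, and all vertices are
   within 1/(2N) per coordinate. *)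
pose t0 := grid_point R N (x ord0).
have [sL _ pL] := LP t0.
have inL l : best (grid_point R N (x l)) \in L t0.
  apply/negPn/negP => hL.
  have small := unlikely_output mout hL pL.
  have [_ large] := bestP (grid_point R N (x l)).
  have := perturbed_output_prob A delta eps m (best (grid_point R N (x l)))
    _ (fun i => grid_point_near R N (vx l i) (vx ord0 i)).
  rewrite invr_ge0 mulr_ge0 // => /(_ isT) close.
  have := le_trans large (le_trans close (leeD small (lexx _))).
  rewrite -EFinD lee_fin; apply/negP; rewrite -ltNge.
  exact: error_gap.
have := uniq_leq_size (s1 := [seq best (grid_point R N (x l)) | l <- enum 'I_d.+1]) (s2 := L t0).
rewrite map_inj_uniq // enum_uniq size_map size_enum_ord => /(_ isT) H.
have : (d.+1 <= size (L t0))%N by apply: H => _ /mapP[l _ ->]; exact: inL.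
by move=> /leq_trans /(_ sL); rewrite leqNgt hk.
Qed.
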